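(* Let $p,q\geq0$ be integers and let $X_1,\ldots,X_p,Y_1,\ldots,Y_q$ be independent real random variables such that $X_1,\ldots,X_p$ all have the same moments $\mu_j=\mathrm{E}(X_i^j)$, finite for all $j\geq0$, and $Y_1,\ldots,Y_q$ all have the same moments $\nu_j=\mathrm{E}(Y_i^j)$, finite for all $j\geq0$. Let $S_{p,q}=X_1+\cdots+X_p+Y_1+\cdots+Y_q$. Then for every integer $n\geq0$, $$\mathrm{E}\left(S_{p,q}^n\right)=\binom{n+p}{p}^{-1}B^{(q)}_{n+p+q,\,p+q}(1\mu_0,2\mu_1,3\mu_2,\ldots;\nu_0,\nu_1,\nu_2,\ldots),$$ i.e. the arguments are $a_l=l\mu_{l-1}$ and $b_l=\nu_{l-1}$ for $l\geq1$.
   Context: For sequences $a=(a_l)_{l\geq1}$, $b=(b_l)_{l\geq1}$ and integers $N,K,r\geq0$, the partial $r$-Bell polynomial is $$B^{(r)}_{N,K}(a_1,a_2,\ldots;b_1,b_2,\ldots)=\sum_{\pi}\ \prod_{B\in\pi,\ B\cap\{1,\ldots,r\}=\emptyset}a_{|B|}\prod_{B\in\pi,\ B\cap\{1,\ldots,r\}\neq\emptyset}b_{|B|},$$ where $\pi$ ranges over the partitions of $\{1,\ldots,N\}$ into exactly $K$ nonempty blocks such that $1,\ldots,r$ lie in pairwise distinct blocks (an empty sum is $0$; the empty partition of the empty set contributes $1$). *)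

(* Defs.v *)
From HB Require Import structures.
From mathcomp Require Import all_boot all_order all_algebra.

Set Implicit Arguments.
Unset Strict Implicit.
Unset Printing Implicit Defensive.

Import Order.TTheory GRing.Theory Num.Theory.

Local Open Scope ring_scope.

(* The ground set {1, ..., N} is encoded as 'I_N, so that the element k of the
   ground set is the ordinal of value k - 1, and {1, ..., r} becomes: *)
Definition first_elts (N r : nat) : {set 'I_N} := [set i : 'I_N | (i < r)%N].

(* The conjunct (r <= N) says that 1, ..., r all belong to the ground set;
   without it they cannot lie in blocks and no partition is admissible. *)
Definition r_partition (N K r : nat) (pi : {set {set 'I_N}}) : bool :=
  [&& partition pi [set: 'I_N], #|pi| == K, (r <= N)%N &
      [forall i in first_elts N r, forall j in first_elts N r,
         (i != j) ==> (pblock pi i != pblock pi j)]].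

(* The sequences are indexed from 1; a 0 and b 0 are never used, since the
   blocks of a partition are nonempty. *)
Definition rBell (R : comPzSemiRingType) (r N K : nat) (a b : nat -> R) : R :=
  \sum_(pi : {set {set 'I_N}} | r_partition K r pi)
     ((\prod_(B in pi | [disjoint B & first_elts N r]) a #|B|) *
      (\prod_(B in pi | ~~ [disjoint B & first_elts N r]) b #|B|)).

From mathcomp Require Import all_classical all_reals all_analysis.

Local Open Scope classical_set_scope.

Definition mutually_independent (d : measure_display) (T : measurableType d)
    (R : realType) (P : probability T R) (I : finType)
    (Z : I -> {RV P >-> R}) : Prop :=
  forall (J : {set I}) (A : I -> set R),
    (forall i, measurable (A i)) ->
    P (\bigcap_(i in [set` J]) (Z i @^-1` A i)) =
    (\prod_(i in J) P (Z i @^-1` A i))%E.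

(* Main.v *)
(** Expanding the n-th power of a sum of p + q independent variables indexed by
    a set M gives one term for each map from an n-element set to M. Taking M
    inside V = {1, ..., n+p+q}, with D = {1, ..., q} contained in M, these maps
    become the idempotent maps F of V with set of fixed points M, and
    independence turns the term of F into a product over M depending only on the
    fiber sizes. Summing over the 'C(n + p, p) possible M gives all idempotent
    maps that fix D and have p + q fixed points. Grouping them instead by their
    kernel partition gives the r-Bell polynomial: such a map amounts to an
    r-partition with a marked element in each block, which is forced in a block
    meeting D and can be chosen in #|B| ways in any other block B; hence the
    weight l * mu_(l-1). *)

Require Import Defs.
From HB Require Import structures.
From mathcomp Require Import all_boot all_order all_algebra.

Import Order.TTheory GRing.Theory Num.Theory.

Local Open Scope ring_scope.

(** * Idempotent maps that fix [D], and their kernel partitions *)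

Section RootedMaps.
Variables (V : finType) (D : {set V}).
Implicit Types (F : {ffun V -> V}) (pi : {set {set V}}).

Definition roots F : {set V} := [set x | F x == x].

Definition rooted_map F : bool := [forall x, F x \in roots F] && (D \subset roots F).

Definition kernel F : {set {set V}} := preim_partition F [set: V].

Definition separates pi : Prop := {in D &, injective (pblock pi)}.

Lemma rooted_mapP F :
  reflect ((forall x, F (F x) = F x) /\ {in D, forall x, F x = x}) (rooted_map F).
Proof.
apply: (iffP andP) => [[/forallP FF /subsetP DF]|[FF DF]]; split.
- by move=> x; have := FF x; rewrite inE => /eqP.
- by move=> x /DF; rewrite inE => /eqP.
- by apply/forallP => x; rewrite inE FF.
- by apply/subsetP => x /DF Fx; rewrite inE Fx.
Qed.

Lemma pblock_kernel F x : pblock (kernel F) x = F @^-1: [set F x].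
Proof.
apply/setP => y; rewrite pblock_equivalence_partition ?inE 1?eq_sym//.
by split=> // /eqP ->.
Qed.

Lemma eq_pblock_kernel F x y :
  (pblock (kernel F) x == pblock (kernel F) y) = (F x == F y).
Proof.
rewrite eq_pblock ?(partition_trivIset (preim_partitionP F _))//; last first.
  by rewrite (cover_partition (preim_partitionP F _)).
by rewrite pblock_kernel !inE eq_sym.
Qed.

Lemma kernelP F pi : partition pi [set: V] ->
  reflect (forall x y, (F x == F y) = (pblock pi x == pblock pi y))
          (kernel F == pi).
Proof.
move=> piP; apply: (iffP eqP) => [<- x y|Fpi]; first by rewrite eq_pblock_kernel.
(* [pi] is itself the kernel of the map [pblock pi], so both sides are preimage partitions and can
   be compared block by block. *)
rewrite -[RHS](preim_partition_pblock piP) /kernel /preim_partition.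
rewrite /equivalence_partition; apply: eq_in_imset => x _.
by apply/setP => y; rewrite !inE Fpi.
Qed.

Lemma separates_kernel F : rooted_map F -> separates (kernel F).
Proof.
move=> /rooted_mapP [_ DF] x y Dx Dy /eqP.
by rewrite eq_pblock_kernel !DF// => /eqP.
Qed.

(** Idempotence makes [F x] a root, so the block of [x] is the fiber over [F x]; conversely a root
    lies in its own fiber, which is therefore its block. *)
Lemma kernel_roots F : rooted_map F ->
  kernel F = [set F @^-1: [set x] | x in roots F].
Proof.
move=> /rooted_mapP [FF _]; have piP := preim_partitionP F [set: V].
apply/setP => B; apply/idP/imsetP => [Bpi|[x]].
  have [x Bx] : exists x, x \in B.
    by apply/set0Pn; apply: contraTneq Bpi => ->; case/and3P: piP.
  exists (F x); first by rewrite inE FF.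
  by rewrite -pblock_kernel (def_pblock (partition_trivIset piP) Bpi).
rewrite inE => /eqP Fx ->; rewrite -{1}Fx -pblock_kernel.
by rewrite pblock_mem// (cover_partition piP) inE.
Qed.

Lemma fiber_roots_inj F : {in roots F &, injective (fun x => F @^-1: [set x])}.
Proof.
move=> x y; rewrite !inE => /eqP Fx /eqP Fy /setP/(_ x).
by rewrite !inE Fx eqxx => /esym/eqP.
Qed.

Lemma card_kernel F : rooted_map F -> #|kernel F| = #|roots F|.
Proof. by move=> FP; rewrite kernel_roots// card_in_imset//; exact: fiber_roots_inj. Qed.

(** A point [y] of [D] in the fiber satisfies [y = F y = x], so the root is the only point of the
    fiber that can lie in [D]. *)
Lemma disjoint_fiber F x : rooted_map F -> x \in roots F ->
  [disjoint F @^-1: [set x] & D] = (x \notin D).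
Proof.
move=> /rooted_mapP [_ DF]; rewrite inE => /eqP Fx.
apply/pred0P/idP => [/(_ x)/=|xD y /=].
  by rewrite !inE Fx eqxx => /negbT.
rewrite !inE; apply/negbTE/negP => /andP[/eqP Fyx yD].
by move: xD; rewrite -Fyx DF// yD.
Qed.

Lemma prod_roots (R : comPzSemiRingType) (w : bool -> nat -> R) F : rooted_map F ->
  \prod_(x in roots F) w (x \in D) #|F @^-1: [set x]| =
  \prod_(B in kernel F) w (~~ [disjoint B & D]) #|B|.
Proof.
move=> FP; rewrite kernel_roots// big_imset/=; last exact: fiber_roots_inj.
by apply: eq_bigr => x Fx; rewrite disjoint_fiber// negbK.
Qed.

(** The empty ground set is treated apart because the general count uses a default point [x0]. Here
    there are one map, one partition and an empty product. *)
Lemma card_rooted_kernel_void pi : #|V| = 0%N -> partition pi [set: V] ->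
  #|[set F | rooted_map F && (kernel F == pi)]| =
  (\prod_(B in pi | [disjoint B & D]) #|B|)%N.
Proof.
move=> V0 piP; have noV (x : V) : False by have := fintype0 x V0.
have part0 (s : {set {set V}}) : partition s [set: V] -> s = set0.
  by rewrite (_ : [set: V] = set0) ?partition_set0 => [/eqP|]//;
    apply/setP => x; case: (noV x).
rewrite (part0 _ piP) big1 => [|B]; last by rewrite inE.
transitivity #|{ffun V -> V}|; last by rewrite card_ffun V0.
apply: eq_card => F; rewrite !inE (part0 (kernel F) (preim_partitionP F _)) eqxx andbT.
by apply/rooted_mapP; split=> x; case: (noV x).
Qed.

Lemma card_rooted_kernel pi : partition pi [set: V] -> separates pi ->
  #|[set F | rooted_map F && (kernel F == pi)]| =
  (\prod_(B in pi | [disjoint B & D]) #|B|)%N.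
Proof.
move=> piP sep; have [x0 _|noV] := pickP (@predT V); last first.
  by apply: card_rooted_kernel_void => //; apply: eq_card0.
have triv := partition_trivIset piP; have cov := cover_partition piP.
have pibx x : pblock pi x \in pi by rewrite pblock_mem// cov inE.
have xpib x : x \in pblock pi x by rewrite mem_pblock cov inE.
(* [Q B] collects the admissible roots of [B]: points of [D] are fixed, so a block that meets [D]
   must have its root there. *)
pose Q (B : {set V}) := if [disjoint B & D] then B else B :&: D.
(* Choices take the default value [x0] off [pi], so that a choice is determined by its values on the
   blocks. *)
pose choices : {pred {ffun {set V} -> V}} :=
  pfamily x0 (mem pi) (fun B => mem (Q B)).
pose rooted (c : {ffun {set V} -> V}) := [ffun x => c (pblock pi x)].
have QB B x : x \in Q B -> x \in B.
  by rewrite /Q; case: ifP => // _; rewrite inE => /andP[].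
have -> : [set F | rooted_map F && (kernel F == pi)] = [set rooted c | c in choices].
  apply/setP => F; rewrite inE; apply/andP/imsetP => [[FP /(kernelP _ _ piP) kerF]|].
    have /rooted_mapP[FF DF] := FP.
    (* [F] is constant on each block, so any element of [B] yields the root of [B]. *)
    exists [ffun B : {set V} => if [pick x in B | B \in pi] is Some x then F x else x0].
      apply/pfamilyP; split=> [|B Bpi].
        apply/subsetP => B; rewrite inE ffunE; case: pickP => [x /andP[]|]//.
        by move=> _; rewrite eqxx.
      rewrite ffunE; case: pickP => [x /andP[Bx _]|noB]; last first.
        have /set0Pn[x Bx] : B != set0.
          by apply: contraTneq Bpi => ->; case/and3P: piP.
        by have := noB x; rewrite /= Bx Bpi.
      have Bdef : pblock pi x = B by exact: def_pblock.
      have BF : F x \in B.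
        have /eqP : pblock pi (F x) == pblock pi x by rewrite -kerF FF.
        by rewrite Bdef => <-.
      rewrite /Q; case: ifPn => // /pred0Pn[y /= /andP[By Dy]].
      suff -> : F x = y by rewrite inE By.
      by apply/eqP; rewrite -(DF y)// kerF Bdef (def_pblock triv Bpi By).
    apply/ffunP => x; rewrite !ffunE; case: pickP => [y /andP[xy _]|/(_ x)].
      by apply/eqP; rewrite kerF (same_pblock triv xy).
    by rewrite /= xpib pibx.
  move=> [c /pfamilyP[_ cQ] ->].
  have cx x : pblock pi (c (pblock pi x)) = pblock pi x.
    by apply: same_pblock => //; apply: QB; exact: cQ.
  split.
    apply/rooted_mapP; split=> [x|x Dx]; first by rewrite !ffunE cx.
    rewrite ffunE; have := cQ _ (pibx x); rewrite /Q.
    case: ifPn => [/pred0P/(_ x)|_]; first by rewrite /= xpib Dx.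
    by rewrite inE => /andP[_ Dc]; apply: sep => //; rewrite cx.
  apply/(kernelP _ _ piP) => x y; rewrite !ffunE.
  by apply/eqP/eqP => [/(congr1 (pblock pi))|->//]; rewrite !cx.
rewrite card_in_imset => [|c1 c2 /pfamilyP[s1 _] /pfamilyP[s2 _] /ffunP c12].
  (* By distributivity the number of choices is the product of the [#|Q B|]. If [B] meets [D], then
     [separates] makes [B :&: D] a singleton and the factor is 1. *)
  transitivity (\sum_(c in choices) \prod_(B in pi) 1)%N.
    by rewrite -sum1_card; apply: eq_bigr => c _; rewrite big1_eq.
  rewrite -(big_distr_big_dep x0 (mem pi) (fun B => mem (Q B)) (fun=> fun=> 1%N)).
  rewrite big_mkcondr/=; apply: eq_bigr => B Bpi.
  rewrite sum1_card /Q; case: ifPn => // /pred0Pn[x /= /andP[Bx Dx]].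
  rewrite (_ : B :&: D = [set x]) ?cards1//; apply/setP => y.
  rewrite !inE; apply/andP/eqP => [[By Dy]|->//].
  by apply: sep => //; rewrite !(def_pblock triv Bpi).
apply/ffunP => B; have [Bpi|Bpi] := boolP (B \in pi).
  have /set0Pn[x Bx] : B != set0.
    by apply: contraTneq Bpi => ->; case/and3P: piP.
  by have := c12 x; rewrite !ffunE (def_pblock triv Bpi).
by move/supportP: s1 => ->//; move/supportP: s2 => ->.
Qed.

(** * The power of a sum as a sum over idempotent maps *)

(** Once the root set is prescribed, the values are chosen independently: a point of [M] is fixed,
    any other point goes anywhere in [M]. Distributivity of products over sums produces such
    families. *)
Lemma rooted_family (M : {set V}) F : D \subset M ->
  (F \in family (fun x => if x \in M then pred1 x else mem M)) =
  rooted_map F && (roots F == M).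
Proof.
move=> /subsetP DM; apply/familyP/andP => [FM|[/rooted_mapP[FF _] /eqP <- x]].
  have FxM x : F x \in M.
    by have := FM x; case: ifP => // xM; rewrite inE => /eqP ->.
  have FE x : x \in M -> F x = x by move=> xM; have /= := FM x; rewrite xM => /eqP.
  split; first by apply/rooted_mapP; split=> [x|x /DM]; exact: FE.
  by apply/eqP/setP => x; rewrite inE; apply/eqP/idP => [<-//|/FE].
by case: ifPn => [|_]; rewrite inE ?FF.
Qed.

(** The factors of the power are indexed by the points outside [M]; choosing a summand in each gives
    a map to [M], extended by the identity. The root [y] lies in its own fiber without indexing a
    factor, hence the predecessor in the exponent. *)
Lemma exprn_sum_rooted (R : comPzSemiRingType) (M : {set V}) (z : V -> R) :
  D \subset M ->
  (\sum_(y in M) z y) ^+ #|~: M| =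
  \sum_(F | rooted_map F && (roots F == M))
     \prod_(y in M) z y ^+ #|F @^-1: [set y]|.-1.
Proof.
move=> DM; rewrite -prodr_const.
pose Q x : pred V := if x \in M then pred1 x else mem M.
(* Points of [M] receive dummy factors equal to 1, so that the product can run over all of [V]. *)
pose h x y := if x \in M then 1 else z y.
transitivity (\prod_x \sum_(y | Q x y) h x y).
  rewrite [RHS](bigID (mem M))/= [X in X * _]big1 ?mul1r => [|x xM].
    apply: eq_big => x; rewrite inE // => /negbTE xM.
    by rewrite /Q /h xM.
  by rewrite /Q /h xM big_pred1_eq.
rewrite bigA_distr_big_dep; apply: eq_big => F; first exact: rooted_family.
rewrite rooted_family// => /andP[/rooted_mapP[FF _] /eqP FM].
rewrite (bigID (mem M))/= [X in X * _]big1 ?mul1r => [|x xM]; last by rewrite /h xM.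
rewrite (partition_big F (mem M)) => [|x _]; last by rewrite /= -FM inE FF.
apply: eq_bigr => y yM.
rewrite (eq_bigr (fun=> z y)) => [|x /andP[/negbTE xM /eqP <-]]; last by rewrite /h xM.
have Fy : F y = y by move: yM; rewrite -FM !inE => /eqP.
rewrite prodr_const (cardsD1 y) !inE Fy eqxx; congr (_ ^+ _).
apply: eq_card => x; rewrite !inE; apply/andP/andP=> [[xM /eqP Fx]|[xy /eqP Fx]].
  by rewrite Fx eqxx; split=> //; apply: contraNneq xM => ->.
by rewrite Fx eqxx -FM inE Fx eq_sym.
Qed.

Lemma exprn_sum_rooted_imset (R : comPzSemiRingType) (I : finType) (psi : I -> V)
    (z : I -> R) :
  injective psi -> D \subset psi @: I ->
  (\sum_i z i) ^+ #|~: (psi @: I)| =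
  \sum_(F | rooted_map F && (roots F == psi @: I))
     \prod_i z i ^+ #|F @^-1: [set psi i]|.-1.
Proof.
(* [z'] transports [z] to [V]: over a point of the image of [psi] the sum has exactly one term. *)
move=> psi_inj Dpsi; pose z' y := \sum_(i | psi i == y) z i.
have z'E i : z' (psi i) = z i.
  by rewrite /z' (eq_bigl (pred1 i)) ?big_pred1_eq// => j; rewrite /= (inj_eq psi_inj).
transitivity ((\sum_(y in psi @: I) z' y) ^+ #|~: (psi @: I)|).
  congr (_ ^+ _); rewrite big_imset/=; last by move=> i j _ _; exact: psi_inj.
  by apply: eq_bigr => i _; rewrite z'E.
rewrite exprn_sum_rooted//; apply: eq_bigr => F _.
rewrite big_imset/=; last by move=> i j _ _; exact: psi_inj.
by apply: eq_bigr => i _; rewrite z'E.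
Qed.

(** Removing [D] is a bijection from these [M] onto the [k]-subsets of the complement of [D]. *)
Lemma card_supersets k :
  #|[set M : {set V} | (D \subset M) && (#|M| == k + #|D|)%N]| =
  'C(#|V| - #|D|, k).
Proof.
have -> : (#|V| - #|D|)%N = #|~: D| by rewrite [RHS]cardsCs setCK.
rewrite -cards_draws.
have UDK (A : {set V}) : A \subset ~: D -> (A :|: D) :\: D = A.
  by move=> AD; rewrite setDUl setDv setU0 setDE (setIidPl AD).
rewrite -[RHS](card_in_imset (f := fun A => A :|: D)) => [|A B]; last first.
  rewrite !inE => /andP[/UDK AD _] /andP[/UDK BD _].
  by move=> /(congr1 (fun A => A :\: D)); rewrite AD BD.
apply: eq_card => M; rewrite inE; apply/andP/imsetP => [[DM /eqP Mk]|[A]].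
  exists (M :\: D); last by rewrite -{1}(setID M D) (setIidPr DM) setUC.
  by rewrite inE setDE subsetIr/= -setDE cardsD (setIidPr DM) Mk addnK.
rewrite inE => /andP[AD /eqP Ak] ->; rewrite subsetUr; split=> //.
by rewrite cardsU Ak disjoint_setI0 ?cards0 ?subn0// disjoints_subset.
Qed.

End RootedMaps.
Arguments roots {V} F.
Arguments rooted_map {V} D F.
Arguments kernel {V} F.
Arguments separates {V} D pi.

(** * The r-Bell polynomial as a sum over idempotent maps *)

Lemma card_first_elts (N r : nat) : (r <= N)%N -> #|first_elts N r| = r.
Proof.
move=> rN; have widen_inj : injective (widen_ord rN).
  by move=> i j /(congr1 val)/= ij; exact: val_inj.
rewrite -[RHS]card_ord -(card_imset _ widen_inj).
apply: eq_card => i; rewrite inE; apply/idP/imsetP => [ir|[j _ ->]].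
  by exists (Ordinal ir) => //; apply: val_inj.
by rewrite /= ltn_ord.
Qed.

(* [w b l] is the weight of a block of size l, b telling whether it meets D. *)
Lemma rBell_rooted (R : comPzSemiRingType) (r N K : nat) (w : bool -> nat -> R) :
  (r <= N)%N ->
  rBell r N K (fun l => l%:R * w false l) (w true) =
  \sum_(F : {ffun 'I_N -> 'I_N}
       | rooted_map (first_elts N r) F && (#|roots F| == K))
     \prod_(x in roots F) w (x \in first_elts N r) #|F @^-1: [set x]|.
Proof.
move=> rN; set D := first_elts N r; apply/esym.
rewrite (partition_big kernel (r_partition K r)) => [|F /andP[FP /eqP FK]].
  apply: eq_bigr => pi /and4P[piP /eqP piK _ piD].
  have sep : separates D pi.
    move=> i j iD jD; apply: contra_eq => ij.
    by move/forall_inP/(_ i iD)/forall_inP/(_ j jD): piD; rewrite ij.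
  rewrite (eq_big (mem [set F | rooted_map D F && (kernel F == pi)])
    (fun=> \prod_(B in pi) w (~~ [disjoint B & D]) #|B|)); first last.
  - by move=> F /andP[/andP[FP _] /eqP <-]; rewrite prod_roots.
  - move=> F; rewrite !inE andbAC; apply: andb_idr => /andP[FP /eqP kF].
    by rewrite -(card_kernel _ _ _ FP) kF piK.
  (* All rooted maps with kernel [pi] have the same weight, and their number supplies the factor
     [#|B|] of each block that misses [D]. *)
  rewrite sumr_const card_rooted_kernel// -mulr_natl natr_prod.
  rewrite [X in _ * X = _](bigID (fun B : {set 'I_N} => [disjoint B & D]))/= mulrA -big_split/=.
  congr (_ * _); apply: eq_bigr => B /andP[_ BD]; first by rewrite BD.
  by rewrite BD.
rewrite /r_partition preim_partitionP rN (card_kernel _ _ _ FP) FK eqxx/=.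
apply/forall_inP => i iD; apply/forall_inP => j jD; apply/implyP.
by apply: contraNneq => /(separates_kernel _ _ _ FP _ _ iD jD) ->.
Qed.

(** Serves to place the variables on [M]: the first family outside [D], the second on [D]. *)
Lemma split_set_param (V : finType) (D M : {set V}) (p q : nat) :
  D \subset M -> #|D| = q -> #|M| = (p + q)%N ->
  exists psi : 'I_p + 'I_q -> V,
    [/\ injective psi, psi @: {: 'I_p + 'I_q} = M,
        forall i, psi (inl i) \notin D & forall j, psi (inr j) \in D].
Proof.
move=> DM Dq Mpq; have MDp : #|M :\: D| = p.
  by rewrite cardsD (setIidPr DM) Mpq Dq addnK.
pose psi (k : 'I_p + 'I_q) := match k with
  | inl i => enum_val (cast_ord (esym MDp) i)
  | inr j => enum_val (cast_ord (esym Dq) j) end.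
have psil i : psi (inl i) \in M :\: D by exact: enum_valP.
have psir j : psi (inr j) \in D by exact: enum_valP.
have psilD i : psi (inl i) \notin D by have := psil i; rewrite inE => /andP[].
have psi_inj : injective psi.
  move=> [i|i] [j|j] // psiE.
  - by move/enum_val_inj: psiE => /cast_ord_inj ->.
  - by have := psir j; rewrite -psiE (negbTE (psilD i)).
  - by have := psir i; rewrite psiE (negbTE (psilD j)).
  - by move/enum_val_inj: psiE => /cast_ord_inj ->.
exists psi; split=> //; apply/eqP; rewrite eqEcard card_imset// card_sum !card_ord.
rewrite Mpq leqnn andbT; apply/subsetP => _ /imsetP[[i|j] _ ->].
  by have := psil i; rewrite inE => /andP[].
exact: (subsetP DM).
Qed.

From mathcomp Require Import all_classical all_reals all_analysis.
From mathcomp Require Import measurable_realfun.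

Local Open Scope classical_set_scope.
Local Open Scope ring_scope.

(** * Expectations of products of functions of independent variables *)

Section Independence.
Context d (T : measurableType d) (R : realType).
Import HBNNSimple.

Section Weights.
Variables (mu : {measure set T -> \bar R}) (Z : T -> R).
Hypothesis mZ : measurable_fun [set: T] Z.

(** A simple function is a finite combination of indicators of its level sets, so weighted integrals
    of indicators determine its own. *)
Lemma integral_weight_nnsfun (W : T -> R) (h : {nnsfun R >-> R}) :
  measurable_fun [set: T] W -> (forall t, 0 <= W t) ->
  (\int[mu]_t (W t * h (Z t))%:E =
   \sum_(y \in range h)
      y%:E * \int[mu]_t (W t * \1_(h @^-1` [set y]) (Z t))%:E)%E.
Proof.
move=> mW W0.
have mI (y : R) : measurable_fun [set: T]
    (fun t => (W t * \1_(h @^-1` [set y]) (Z t))%:E).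
  apply/measurable_EFinP/measurable_funM => //.
  by apply: (measurableT_comp (measurable_indic _) mZ).
have I0 y t : (0 <= (W t * \1_(h @^-1` [set y]) (Z t))%:E)%E.
  by rewrite lee_fin mulr_ge0// indicE.
have yI0 y t : (0 <= y%:E * (W t * \1_(h @^-1` [set y]) (Z t))%:E)%E.
  by rewrite EFinM muleCA; apply: mule_ge0;
    [rewrite lee_fin|exact: nnfun_muleindic_ge0].
under eq_integral => t _.
  rewrite fimfunE EFinM -fsumEFin// ge0_mule_fsumr; last first.
    by move=> y; rewrite EFinM nnfun_muleindic_ge0.
  under eq_fsbigr do rewrite EFinM muleCA -EFinM.
  over.
rewrite ge0_integral_fsum//; last 2 first.
- by move=> y /=; under eq_fun do rewrite EFinM; exact: measurable_funeM.
- by move=> y t _; rewrite EFinM.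
apply: eq_fsbigr => y /set_mem [x _ <-].
by under eq_integral do rewrite EFinM; rewrite ge0_integralZl// lee_fin.
Qed.

(** The last hypothesis says that the measures of densities [W] and [V] have the same image under
    [Z]. Equality passes to simple functions by linearity, then to [f] by monotone convergence. *)
Lemma eq_integral_weight (W V : T -> R) (f : R -> R) :
  measurable_fun [set: T] W -> (forall t, 0 <= W t) ->
  measurable_fun [set: T] V -> (forall t, 0 <= V t) ->
  measurable_fun [set: R] f -> (forall x, 0 <= f x) ->
  (forall A, measurable A -> \int[mu]_t (W t * \1_A (Z t))%:E =
                             \int[mu]_t (V t * \1_A (Z t))%:E)%E ->
  (\int[mu]_t (W t * f (Z t))%:E = \int[mu]_t (V t * f (Z t))%:E)%E.
Proof.
move=> mW W0 mV V0 mf f0 WV.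
have mEf : measurable_fun [set: R] (EFin \o f) by exact/measurable_EFinP.
pose f_ := nnsfun_approx measurableT mEf.
suff lim_weight (U : T -> R) : measurable_fun [set: T] U -> (forall t, 0 <= U t) ->
    (\int[mu]_t (U t * f (Z t))%:E =
     limn (fun n => \int[mu]_t (U t * f_ n (Z t))%:E))%E.
  rewrite !lim_weight//; congr (limn _); apply/funext => n.
  rewrite !integral_weight_nnsfun//; apply: eq_fsbigr => y _.
  by rewrite WV.
move=> mU U0; rewrite -monotone_convergence//=.
- apply: eq_integral => t _; apply/esym/cvg_lim => //=.
  under eq_fun do rewrite EFinM.
  rewrite EFinM; apply: cvgeZl => //.
  apply: (@cvg_nnsfun_approx _ _ _ _ measurableT _ mEf) => // x _ /=.
  by rewrite lee_fin.
- move=> n; apply/measurable_EFinP/measurable_funM => //.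
  exact: (measurableT_comp _ mZ).
- by move=> n t _; rewrite lee_fin mulr_ge0.
- move=> t _ a b ab; rewrite lee_fin ler_wpM2l//.
  exact/lefP/nd_nnsfun_approx.
Qed.

End Weights.

Section Product.
Variables (P : probability T R) (I : finType) (Z : I -> {RV P >-> R}).
Hypothesis indepZ : mutually_independent Z.

(** The product of the indicators is the indicator of the intersection of the events, so this is
    independence for the full index set. *)
Lemma integral_prod_indic (A : I -> set R) : (forall i, measurable (A i)) ->
  (\int[P]_t (\prod_i \1_(A i) (Z i t))%:E =
   (\prod_i \int[P]_t (\1_(A i) (Z i t))%R)%R%:E)%E.
Proof.
move=> mA; have mZA i : measurable (Z i @^-1` A i).
  by rewrite -[X in measurable X]setTI; exact: measurable_funP.
have intA i : (\int[P]_t (\1_(A i) (Z i t)) = fine (P (Z i @^-1` A i)))%R.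
  rewrite /Rintegral -[in RHS](setIT (Z i @^-1` A i)) -integral_indic//.
have := indepZ [set: I]%SET _ mA.
rewrite (_ : [set` _] = [set: I]); last first.
  by apply/seteqP; split=> // i _ /=; rewrite inE.
move=> indepA; have {}indepA : (\prod_i \int[P]_t (\1_(A i) (Z i t)))%R%:E =
    P (\bigcap_(i in [set: I]) (Z i @^-1` A i)).
  rewrite indepA -prodEFin; apply: eq_big => i; rewrite ?inE// => _.
  by rewrite intA fineK// fin_num_measure.
rewrite indepA -[in RHS](setIT (\bigcap_(i in _) _)).
have mcap : measurable (\bigcap_(i in [set: I]) (Z i @^-1` A i)).
  exact: fin_bigcap_measurable.
rewrite -integral_indic//; apply: eq_integral => t _; congr (_%:E).
have [/mem_set tA|tA] := pselect ((\bigcap_(i in [set: I]) (Z i @^-1` A i)) t).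
  rewrite [RHS]indicE tA big1// => i _.
  by rewrite indicE mem_set//; move/set_mem: tA; apply.
rewrite [RHS]indicE memNset//.
have [i Ai] : exists i, ~ A i (Z i t).
  by apply/existsNP => At; apply: tA => i _; exact: At.
by rewrite (bigD1 i)//= indicE memNset// mul0r.
Qed.

Lemma integral_prod_ge0 (f : I -> R -> R) :
  (forall i, measurable_fun [set: R] (f i)) -> (forall i x, 0 <= f i x) ->
  (forall i, P.-integrable [set: T] (fun t => (f i (Z i t))%:E)) ->
  (\int[P]_t (\prod_i f i (Z i t))%:E =
   (\prod_i \int[P]_t (f i (Z i t))%R)%R%:E)%E.
Proof.
(* Induction on the set of indices at which [f i] is not an indicator. *)
move: f; suff main (s : seq I) (f : I -> R -> R) :
    (forall i, measurable_fun [set: R] (f i)) -> (forall i x, 0 <= f i x) ->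
    (forall i, P.-integrable [set: T] (fun t => (f i (Z i t))%:E)) ->
    (forall i, i \notin s -> exists2 A, measurable A & f i = \1_A) ->
    (\int[P]_t (\prod_i f i (Z i t))%:E =
     (\prod_i \int[P]_t (f i (Z i t))%R)%R%:E)%E.
  by move=> f mf f0 intf; apply: (main (enum I)) => // i; rewrite mem_enum.
elim: s f => [f _ _ _ fA|i0 s IH f mf f0 intf fA].
  have {}fA i : {A | measurable A & f i = \1_A} by apply: cid2; exact: fA.
  have fE i : f i = \1_(s2val (fA i)) by case: (fA i).
  under eq_integral do under eq_bigr do rewrite fE.
  rewrite integral_prod_indic; last by move=> i; case: (fA i).
  by congr (_%:E); apply: eq_bigr => i _; rewrite -fE.
have mfZ (g : R -> R) i : measurable_fun [set: R] g ->
    measurable_fun [set: T] (fun t => g (Z i t)).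
  by move=> mg; exact: measurableT_comp.
pose W t := \prod_(i | i != i0) f i (Z i t).
pose c := \prod_(i | i != i0) \int[P]_t (f i (Z i t))%R.
have mW : measurable_fun [set: T] W.
  rewrite /W; under eq_fun do rewrite -big_filter.
  by apply: measurable_prod => i _; exact: mfZ.
have W0 t : 0 <= W t by apply: prodr_ge0.
have c0 : 0 <= c by apply: prodr_ge0 => i _; apply: Rintegral_ge0.
have cE (h : T -> R) : P.-integrable [set: T] (fun t => (h t)%:E) ->
    (\int[P]_t (c * h t)%:E = (c * \int[P]_t (h t))%R%:E)%E.
  move=> inth; under eq_integral do rewrite EFinM.
  by rewrite integralZl// EFinM fineK//; exact: integrable_fin_num.
transitivity (\int[P]_t (c * f i0 (Z i0 t))%:E)%E.
  transitivity (\int[P]_t (W t * f i0 (Z i0 t))%:E)%E.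
    by apply: eq_integral => t _; rewrite (bigD1 i0)//= mulrC.
  (* [W] and the constant [c] are two weights for functions of [Z i0], to be compared on indicators
     only. With [\1_A] in place of [f i0], the induction hypothesis applies to the shorter list
     [s]. *)
  apply: eq_integral_weight => // A mA.
  pose g i := if i == i0 then \1_A else f i.
  have intA : P.-integrable [set: T] (fun t => (\1_A (Z i0 t))%:E).
    have : d.-measurable (Z i0 @^-1` A).
      by rewrite -[X in measurable X]setTI; exact: measurable_funP.
    exact: integrable_indic.
  transitivity (\int[P]_t (\prod_i g i (Z i t))%:E)%E.
    apply: eq_integral => t _; rewrite (bigD1 i0)//= /g eqxx mulrC.
    congr ((_ * _)%:E); apply: eq_bigr => i /negbTE ii0.
    by rewrite ii0.
  rewrite IH; first last.
  - move=> i si; rewrite /g; case: ifPn => [_|ii0]; first by exists A.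
    by apply: fA; rewrite inE negb_or ii0.
  - move=> i; rewrite /g; case: eqP => [->|_]; first exact: intA.
    exact: intf.
  - by move=> i x; rewrite /g; case: ifP => // _; rewrite indicE.
  - by move=> i; rewrite /g; case: ifP.
  rewrite cE// (bigD1 i0)//= {1}/g eqxx mulrC; congr ((_ * _)%:E).
  by apply: eq_bigr => i /negbTE ii0; rewrite /g ii0.
by rewrite cE// [in RHS](bigD1 i0)//= mulrC.
Qed.

Lemma integral_prod (f : I -> R -> R) :
  (forall i, measurable_fun [set: R] (f i)) ->
  (forall i, P.-integrable [set: T] (fun t => (f i (Z i t))%:E)) ->
  P.-integrable [set: T] (fun t => (\prod_i f i (Z i t))%:E) /\
  (\int[P]_t (\prod_i f i (Z i t))%:E =
   (\prod_i \int[P]_t (f i (Z i t))%R)%R%:E)%E.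
Proof.
(* Induction on the set of indices at which [f i] may be negative, splitting
   one of these functions into its positive and negative parts. *)
move: f; suff main (s : seq I) (f : I -> R -> R) :
    (forall i, measurable_fun [set: R] (f i)) ->
    (forall i, P.-integrable [set: T] (fun t => (f i (Z i t))%:E)) ->
    (forall i, i \notin s -> forall x, 0 <= f i x) ->
    P.-integrable [set: T] (fun t => (\prod_i f i (Z i t))%:E) /\
    (\int[P]_t (\prod_i f i (Z i t))%:E =
     (\prod_i \int[P]_t (f i (Z i t))%R)%R%:E)%E.
  by move=> f mf intf; apply: (main (enum I)) => // i; rewrite mem_enum.
elim: s f => [f mf intf f0|i0 s IH f mf intf f0].
  have {}f0 i x : 0 <= f i x by exact: f0.
  have fE := integral_prod_ge0 _ mf f0 intf; split=> //.
  (* The product is nonnegative and its integral was just found to be a real number, whence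
     integrability. *)
  apply/integrableP; split.
    apply/measurable_EFinP; apply: measurable_prod => i _.
    exact: measurableT_comp.
  under eq_integral do rewrite gee0_abs ?lee_fin ?prodr_ge0//.
  by rewrite fE ltry.
pose g (h : R -> R) i := if i == i0 then h else f i.
have gE h t : \prod_i g h i (Z i t) = h (Z i0 t) * \prod_(i | i != i0) f i (Z i t).
  rewrite (bigD1 i0)//= /g eqxx; congr (_ * _).
  by apply: eq_bigr => i /negbTE ->.
have IgE h : \prod_i \int[P]_t (g h i (Z i t)) =
    \int[P]_t (h (Z i0 t)) * \prod_(i | i != i0) \int[P]_t (f i (Z i t)).
  rewrite (bigD1 i0)//= /g eqxx; congr (_ * _).
  by apply: eq_bigr => i /negbTE ->.
have IHg (h : R -> R) : measurable_fun [set: R] h -> (forall x, 0 <= h x) ->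
    P.-integrable [set: T] (fun t => (h (Z i0 t))%:E) ->
    P.-integrable [set: T] (fun t => (\prod_i g h i (Z i t))%:E) /\
    (\int[P]_t (\prod_i g h i (Z i t))%:E =
     (\prod_i \int[P]_t (g h i (Z i t))%R)%R%:E)%E.
  move=> mh h0 inth; apply: IH => i; rewrite /g.
  - by case: ifP.
  - by case: eqP => [->|_].
  - by case: ifPn => // ii0 si; apply: f0; rewrite inE negb_or ii0.
have intp : P.-integrable [set: T] (fun t => ((f i0)^\+ (Z i0 t))%:E).
  exact: (@integrable_funrpos _ _ _ P setT (fun t => f i0 (Z i0 t)) measurableT (intf i0)).
have intn : P.-integrable [set: T] (fun t => ((f i0)^\- (Z i0 t))%:E).
  exact: (@integrable_funrneg _ _ _ P setT (fun t => f i0 (Z i0 t)) measurableT (intf i0)).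
have [intgp gpE] := IHg _ (measurable_funrpos (mf i0)) (funrpos_ge0 _) intp.
have [intgn gnE] := IHg _ (measurable_funrneg (mf i0)) (funrneg_ge0 _) intn.
have fBE x : f i0 x = (f i0)^\+ x - (f i0)^\- x.
  by rewrite -[in LHS](funrposBneg (f i0)).
(* The product is linear in its factor at [i0], so it is a difference of two products covered by the
   induction hypothesis. *)
have fE t : \prod_i f i (Z i t) = \prod_i g (f i0)^\+ i (Z i t) -
    \prod_i g (f i0)^\- i (Z i t).
  by rewrite !gE -mulrBl -fBE (bigD1 i0).
under eq_fun do rewrite fE EFinB.
split; first exact: integrableB.
rewrite integralB_EFin// gpE gnE -EFinB !IgE -mulrBl -RintegralB//.
rewrite [in RHS](bigD1 i0)//=; congr ((_ * _)%:E).
by apply: eq_Rintegral => t _; rewrite fBE.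
Qed.

(** Integrability is carried along because the expectation of the expanded power is taken term by
    term. *)
Lemma expectation_prod_expr (m : I -> nat -> R) (k : I -> nat) :
  (forall i j, P.-integrable [set: T] (fun t => (Z i t ^+ j)%:E)) ->
  (forall i j, 'E_P[(fun t => (Z i t ^+ j)%R)]%E = (m i j)%:E) ->
  P.-integrable [set: T] (fun t => (\prod_i Z i t ^+ k i)%:E) /\
  'E_P[(fun t => (\prod_i Z i t ^+ k i)%R)]%E = (\prod_i m i (k i))%:E.
Proof.
move=> intZ ZE.
have [||intZk intE] := integral_prod (fun i x => x ^+ k i).
- by move=> i; exact: measurable_funX.
- by move=> i; exact: intZ.
split=> //; rewrite unlock; apply: etrans intE _; congr (_%:E).
apply: eq_bigr => i _.
by have := ZE i (k i); rewrite unlock /Rintegral => ->.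
Qed.

(** The expansion over rooted maps holds at each [t], and each of its terms is a product of powers
    of independent variables, whose expectation is a product of moments. *)
Lemma expectation_sum_rooted (V : finType) (D : {set V}) (psi : I -> V)
    (m : I -> nat -> R) :
  injective psi -> D \subset (psi @: I)%SET ->
  (forall i j, P.-integrable [set: T] (fun t => (Z i t ^+ j)%:E)) ->
  (forall i j, 'E_P[(fun t => (Z i t ^+ j)%R)]%E = (m i j)%:E) ->
  'E_P[(fun t => ((\sum_i Z i t) ^+ #|(~: (psi @: I))%SET|)%R)]%E =
  (\sum_(F | rooted_map D F && (roots F == psi @: I)%SET)
     \prod_i m i #|(F @^-1: [set psi i])%SET|.-1)%:E.
Proof.
move=> psi_inj Dpsi intZ ZE.
have mom (F : {ffun V -> V}) := expectation_prod_expr m (fun i => #|(F @^-1: [set psi i])%SET|.-1) intZ ZE.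
rewrite unlock /=; under eq_integral do rewrite (exprn_sum_rooted_imset _ D)// -sumEFin.
rewrite integral_sum//; last by move=> F; have [] := mom F.
rewrite -sumEFin; apply: eq_bigr => F _.
by have [_] := mom F; rewrite unlock.
Qed.

End Product.
End Independence.

(** * Summation over all root sets *)

Theorem theorem4 (R : realType) (d : measure_display) (T : measurableType d)
    (P : probability T R) (p q : nat)
    (X : 'I_p -> {RV P >-> R}) (Y : 'I_q -> {RV P >-> R})
    (mu nu : nat -> R)
    (hindep : mutually_independent
       (fun k : 'I_p + 'I_q => match k with inl i => X i | inr j => Y j end))
    (hXint : forall (i : 'I_p) (j : nat),
       P.-integrable [set: T] (fun t => (X i t ^+ j)%:E))
    (hX : forall (i : 'I_p) (j : nat),
       'E_P[(fun t => (X i t ^+ j)%R)]%E = (mu j)%:E)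
    (hYint : forall (i : 'I_q) (j : nat),
       P.-integrable [set: T] (fun t => (Y i t ^+ j)%:E))
    (hY : forall (i : 'I_q) (j : nat),
       'E_P[(fun t => (Y i t ^+ j)%R)]%E = (nu j)%:E)
    (n : nat) :
  'E_P[(fun t => ((\sum_(i < p) X i t + \sum_(i < q) Y i t) ^+ n)%R)]%E =
  ('C(n + p, p)%:R^-1 *
   rBell q (n + p + q) (p + q)
     (fun l => l%:R * mu l.-1) (fun l => nu l.-1))%:E.
Proof.
set S := fun t => _; have qN : (q <= n + p + q)%N by exact: leq_addl.
pose D := first_elts (n + p + q) q; have Dq : #|D| = q by exact: card_first_elts.
pose w (b : bool) l := if b then nu l.-1 else mu l.-1.
pose weight (F : {ffun 'I_(n + p + q) -> 'I_(n + p + q)}) :=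
  \prod_(x in roots F) w (x \in D) #|(F @^-1: [set x])%SET|.
(* Every admissible [M] gives an expansion of the same moment, with the [X] variables on [M :\: D]
   and the [Y] variables on [D]. *)
have momentE (M : {set 'I_(n + p + q)}) : D \subset M -> #|M| = (p + q)%N ->
    'E_P[S]%E = (\sum_(F | rooted_map D F && (roots F == M)) weight F)%:E.
  move=> DM Mpq; have [psi [psi_inj psiM psil psir]] := split_set_param _ _ _ _ _ DM Dq Mpq.
  pose m (k : 'I_p + 'I_q) := match k with inl _ => mu | inr _ => nu end.
  have := expectation_sum_rooted _ _ _ _ _ _ hindep _ D psi m psi_inj.
  rewrite psiM => /(_ DM) EM.
  have -> : S = (fun t => (\sum_k match k with inl i => X i | inr j => Y j end t) ^+
      #|(~: M)%SET|).
    (* The complement of [M] has [n + p + q - (p + q) = n] points, which is the exponent. *)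
    apply/funext => t; rewrite /S big_sumType/= cardsCs finset.setCK Mpq card_ord.
    by rewrite -addnA addnK.
  rewrite EM => [|[i|i] j|[i|i] j] //.
  congr (_%:E); apply: eq_bigr => F /andP[_ /eqP FM].
  rewrite /weight FM -psiM big_imset/=; last by move=> k l _ _; exact: psi_inj.
  apply: eq_bigr => -[i|j] _; first by rewrite /w (negbTE (psil i)).
  by rewrite /w psir.
have Cgt0 : (0 < 'C(n + p, p))%N by rewrite bin_gt0 leq_addl.
have card_M : #|[set M : {set 'I_(n + p + q)} | (D \subset M) && (#|M| == p + q)%N]%SET|
    = 'C(n + p, p).
  by have := card_supersets _ D p; rewrite Dq card_ord addnK.
(* [M0] is a reference root set; it exists because the binomial coefficient is positive. *)
have [M0] : exists M, M \in
    [set M : {set 'I_(n + p + q)} | (D \subset M) && (#|M| == p + q)%N]%SET.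
  by apply/set0Pn; rewrite -card_gt0 card_M.
rewrite inE => /andP[DM0 /eqP M0pq]; have ES := momentE _ DM0 M0pq.
rewrite {1}ES; congr (_%:E).
have -> : rBell q (n + p + q) (p + q) (fun l => l%:R * mu l.-1) (fun l => nu l.-1) =
    \sum_(F | rooted_map D F && (#|roots F| == p + q)%N) weight F.
  exact: (rBell_rooted _ _ _ _ w).
rewrite [in RHS](partition_big roots (fun M => (D \subset M) && (#|M| == p + q)%N)) =>
    [|F /andP[/andP[_ DF] ->]]; last by rewrite DF.
(* The inner sums for [M] and [M0] agree because both equal the moment, which is thus counted once
   for each of the ['C(n + p, p)] root sets. *)
rewrite [in RHS](eq_bigr (fun=> \sum_(F | rooted_map D F && (roots F == M0)) weight F)); last first.
  move=> M /andP[DM /eqP Mpq]; apply: EFin_inj; rewrite -ES (momentE M)//.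
  congr (_%:E); apply: eq_bigl => F; rewrite andbAC; apply: andb_idr.
  by move=> /andP[_ /eqP ->]; rewrite Mpq.
rewrite sumr_const -cardsE card_M -[X in _ = _ * X]mulr_natl mulrA mulVf ?mul1r//.
by rewrite pnatr_eq0 -lt0n.
Qed.
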